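(* Let $F:D(F)\subseteq\mathcal X\to\mathcal Y$, $f^\dagger$, $g^\dagger=F(f^\dagger)$, the Hilbert scale $\{\mathcal X_\nu\}_{\nu\in\mathbb R}$ and the indices $a,s,u$ satisfy the Basic Assumption, let the Conditional Stability Assumption hold with concave index function $\varphi$, and let the Stochastic Assumption (including its interpolation inequality) hold with Gelfand triple $(\mathcal V,\mathcal Y,\mathcal V')$, exponent $\theta\in(0,1)$ and radius $\rho>0$ (all three assumptions are spelled out in the context). Let the data be $g^{\mathrm{obs}}=g^\dagger+\sigma Z+\delta\xi$ with a centered Gaussian white noise $Z$ on $\mathcal Y$, a deterministic $\xi\in\mathcal Y$ with $\|\xi\|_{\mathcal Y}\le1$, and $\sigma,\delta>0$, and let $$\hat f_\alpha\in\operatorname*{argmin}_{f\in D(F)}\left[\tfrac12\|F(f)\|_{\mathcal Y}^2-\langle F(f),g^{\mathrm{obs}}\rangle+\alpha\|f\|_s^2\right].$$ Put $\psi_{u,s,a}(t):=\left(\varphi(\sqrt t)\right)^{\frac{2(u-s)}{a+u}}$, $t\ge0$. If there are $\sigma_0,\delta_0>0$ and $\alpha>0$ is chosen such that $\hat f_\alpha\in D_\rho^s(f^\dagger)$ for all $0<\sigma\le\sigma_0$, $0<\delta\le\delta_0$, then we have (surely) the error estimate $$\tfrac18\|F(\hat f_\alpha)-g^\dagger\|_{\mathcal Y}^2+\tfrac\alpha4\|\hat f_\alpha-f^\dagger\|_s^2\le C\left[\sigma^2\|Z\|_{\mathcal V'}^2\,\alpha^{\theta-1}+\delta^2+\alpha\,(-\psi_{u,s,a})^*\left(-\frac1{8C\alpha}\right)\right]$$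 for some constant $C>0$, where $(-\psi_{u,s,a})^*(-v)=\sup_{t\ge0}[\psi_{u,s,a}(t)-vt]$ for $v>0$.
   Context: $\mathcal X$ (norm $\|\cdot\|$) and $\mathcal Y$ (norm $\|\cdot\|_{\mathcal Y}$) are infinite-dimensional separable real Hilbert spaces, $F:D(F)\subseteq\mathcal X\to\mathcal Y$ is a possibly nonlinear operator, and $f^\dagger\in D(F)$ is the unique solution of $F(f)=g$ for the exact right-hand side $g=g^\dagger=F(f^\dagger)$. The equation is assumed locally ill-posed at $f^\dagger$: for arbitrarily small $r>0$ there is a sequence $(f_n)\subset D(F)$ with $\|f_n-f^\dagger\|\le r$, $\liminf_n\|f_n-f^\dagger\|>0$ and $\|F(f_n)-F(f^\dagger)\|_{\mathcal Y}\to0$. Hilbert scale: $L:D(L)\subset\mathcal X\to\mathcal X$ is a densely defined, closed, unbounded, self-adjoint linear operator that is strictly positive, with $\|Lx\|\ge m\|x\|$ for all $x\in D(L)$ and some $m>0$. It generates the Hilbert scale $\mathcal X_\nu=D(L^\nu)$, $\nu\in\mathbb R$, $\mathcal X_0=\mathcal X$, with norms $\|x\|_\nu=\|L^\nu x\|$ (for $\nu<0$, completion of $\mathcal X$ in this norm). In the Tikhonov functional $\|f\|_s=\infty$ if $f\notin\mathcal X_s$. Balls: $D_\mu^\nu(\bar f)=\{f\in\mathcal X_\nu:\|f-\bar f\|_\nu\le\mu\}\cap D(F)$. Index function: a continuous, strictly increasing function $\varphi:[0,\infty)\to[0,\infty)$ with $\varphi(0)=0$. Noise: a Hilbert space process $Z$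 on $\mathcal Y$ is a bounded linear map $Z:\mathcal Y\to L^2(\Omega,\mathcal A,\mathbb P)$ for a probability space $(\Omega,\mathcal A,\mathbb P)$; one writes $\langle Z,g\rangle:=Z(g)$. It is centered if $\mathbb E\langle Z,g\rangle=0$ for all $g$, white if $\mathrm{Cov}[\langle Z,g_1\rangle,\langle Z,g_2\rangle]=\langle g_1,g_2\rangle$ for all $g_1,g_2$, and Gaussian if $(\langle Z,g_1\rangle,\dots,\langle Z,g_n\rangle)$ is multivariate Gaussian for all $g_1,\dots,g_n\in\mathcal Y$ and $n\in\mathbb N$. The data are understood weakly: for $g\in\mathcal Y$ one observes $\langle g^{\mathrm{obs}},g\rangle=\langle g^\dagger,g\rangle+\delta\langle g,\xi\rangle+\sigma\langle Z,g\rangle$. Since the embedding $\mathcal V\hookrightarrow\mathcal Y$ below is Hilbert--Schmidt, $Z$ can be regarded as a random element of $\mathcal V'$ with $\|Z\|_{\mathcal V'}<\infty$ almost surely, and $\langle Z,g\rangle$ for $g\in\mathcal V$ is the dual pairing. Basic Assumption: (a) $D(F)$ is a convex and closed subset of $\mathcal X$. (b) $F$ is weak-to-weak sequentially continuous: $x_n\rightharpoonup\bar x$ in $\mathcal X$ with $x_n\in D(F)$ and $\bar x\in D(F)$ implies $F(x_n)\rightharpoonup F(\bar x)$ in $\mathcal Y$. (c) There is $u>0$ with $f^\dagger\in\mathcal X_u$, where $f^\dagger\in D(F)$ is the unique solution of $F(f)=g$. (d) There are indices $a,s\in\mathbb R$ with $a\ge0$, $0\le s<u\le2s+a$ and $-a<s$.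 Conditional Stability Assumption: there are a concave index function $\varphi$, values $\theta_0\ge0$, $\rho_0>0$, $R>0$ and a subset $Q\subseteq D_{\rho_0}^{\theta_0}(f^\dagger)$ such that $\|f-f^\dagger\|_{-a}\le R\,\varphi(\|F(f)-F(f^\dagger)\|_{\mathcal Y})$ for all $f\in Q$, where $R$ may depend on $a$, $\varphi$ and $Q$. Stochastic Assumption: there is a Gelfand triple $(\mathcal V,\mathcal Y,\mathcal V')$ ($\mathcal V$ continuously and densely embedded in $\mathcal Y$, $\mathcal V'$ its dual, $\mathcal Y$ identified with its own dual) such that the embedding $\iota:\mathcal V\hookrightarrow\mathcal Y$ is Hilbert--Schmidt, and $F$ satisfies the interpolation inequality $$\|F(f)-g^\dagger\|_{\mathcal V}\le C_\theta(\rho)\,\|F(f)-g^\dagger\|_{\mathcal Y}^{\theta}\,\|f-f^\dagger\|_s^{1-\theta}\qquad\text{for all }f\in D_\rho^s(f^\dagger)$$ with some constant $C_\theta(\rho)$, $\rho>0$ and $\theta\in(0,1)$. Fenchel conjugate: $h^*(y)=\sup_x[xy-h(x)]$, where functions defined on $[0,\infty)$ (here $-\psi_{u,s,a}$) are extended by $+\infty$ to negative arguments.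
   Formalization: The formal theorem additionally assumes that the minimizers lie in the set Q on which the conditional stability estimate holds; without this the claim fails, for example with Q consisting only of the exact solution and an exponentially ill-posed linear F. *)

(* Defs.v *)
From HB Require Import structures.
From mathcomp Require Import all_boot all_order all_algebra.
From mathcomp Require Import all_classical all_reals all_analysis.

Set Implicit Arguments.
Unset Strict Implicit.
Unset Printing Implicit Defensive.
Import Order.TTheory GRing.Theory Num.Theory.
Import numFieldNormedType.Exports.

Local Open Scope classical_set_scope.
Local Open Scope ring_scope.

(** ** Real Hilbert spaces *)

(* A Hilbert space is a complete normed module whose norm comes from an inner
   product, here given as a separate function [ip]. *)
Definition inner_product {R : realType} {X : completeNormedModType R}
    (ip : X -> X -> R) : Prop :=
  [/\ forall x y, ip x y = ip y x,
      forall (c : R) x y z, ip (c *: x + y) z = c * ip x z + ip y z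
    & forall x, ip x x = `|x| ^+ 2].

Definition separable (T : topologicalType) : Prop :=
  exists2 D : set T, countable D & dense D.

Definition infinite_dimensional {R : realType} (X : lmodType R) : Prop :=
  forall (n : nat) (e : 'I_n -> X),
    exists x : X, forall c : 'I_n -> R, x <> \sum_(i < n) c i *: e i.

Definition weak_cvg {R : realType} {X : completeNormedModType R}
    (ip : X -> X -> R) (x_ : nat -> X) (x : X) : Prop :=
  forall z, ip (x_ n) z @[n --> \oo] --> ip x z.

Definition weak_to_weak_continuous {R : realType}
    {X Y : completeNormedModType R} (ipX : X -> X -> R) (ipY : Y -> Y -> R)
    (DF : set X) (F : X -> Y) : Prop :=
  forall (x_ : nat -> X) (x : X), (forall n, DF (x_ n)) -> DF x ->
    weak_cvg ipX x_ x -> weak_cvg ipY (F \o x_) (F x).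

Definition orthonormal_basis {R : realType} {X : completeNormedModType R}
    (ip : X -> X -> R) (e : nat -> X) : Prop :=
  (forall i j, ip (e i) (e j) = (i == j)%:R) /\
  (forall x, (forall i, ip x (e i) = 0) -> x = 0).

(* Bases are indexed by [nat]: a space that embeds injectively by a
   Hilbert-Schmidt map is separable. *)
Definition hilbert_schmidt {R : realType} {V Y : completeNormedModType R}
    (ipV : V -> V -> R) (A : V -> Y) : Prop :=
  exists2 e : nat -> V, orthonormal_basis ipV e
    & cvgn [series `|A (e n)| ^+ 2]_n.

(** ** The Hilbert scale *)

(* The unbounded operator with domain [DL]; the values of [L] outside [DL] are
   irrelevant. *)
Definition linear_on {R : realType} {X : completeNormedModType R}
    (DL : set X) (L : X -> X) : Prop :=
  DL 0 /\ forall (c : R) x y, DL x -> DL y ->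
    DL (c *: x + y) /\ L (c *: x + y) = c *: L x + L y.

Definition closed_operator {R : realType} {X : completeNormedModType R}
    (DL : set X) (L : X -> X) : Prop :=
  forall (x_ : nat -> X) (x y : X), (forall n, DL (x_ n)) ->
    x_ n @[n --> \oo] --> x -> L (x_ n) @[n --> \oo] --> y ->
    DL x /\ L x = y.

Definition unbounded_operator {R : realType} {X : completeNormedModType R}
    (DL : set X) (L : X -> X) : Prop :=
  ~ exists C : R, forall x, DL x -> `|L x| <= C * `|x|.

(* The graph of the adjoint (left) is the graph of L (right). *)
Definition self_adjoint {R : realType} {X : completeNormedModType R}
    (ip : X -> X -> R) (DL : set X) (L : X -> X) : Prop :=
  forall y z, (forall x, DL x -> ip (L x) y = ip x z) <-> (DL y /\ L y = z).

Definition scale_generator {R : realType} {X : completeNormedModType R}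
    (ip : X -> X -> R) (DL : set X) (L : X -> X) : Prop :=
  [/\ linear_on DL L, dense DL, closed_operator DL L,
      unbounded_operator DL L & self_adjoint ip DL L] /\
  (forall x, DL x -> x <> 0 -> 0 < ip (L x) x) /\
  (exists2 m : R, 0 < m & forall x, DL x -> m * `|x| <= `|L x|).

(* Data of a spectral representation of an operator of X as a multiplication
   operator on L^2(T, smu); [sU x] is a representative of the image of x. *)
Record spectral_data {R : realType} (X : completeNormedModType R)
    {d : measure_display} (T : measurableType d) := SpectralData {
  smu : {finite_measure set T -> \bar R} ;
  slam : T -> R ;
  sU : X -> T -> R }.

(* Spectral theorem in multiplication form: sU is (up to null sets) a unitary
   map of X onto L^2(smu) that carries L to the multiplication by slam on its
   maximal domain. For L strictly positive on a separable space such data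
   exist, with slam positive, and the operators L^nu below do not depend on
   them. *)
Definition diagonalizes {R : realType} {X : completeNormedModType R}
    {d : measure_display} {T : measurableType d} (S : spectral_data X T)
    (DL : set X) (L : X -> X) : Prop :=
  [/\ measurable_fun setT (slam S), forall t, 0 < slam S t &
      [/\ forall x, sU S x \in Lfun (smu S) 2%:E,
          forall (c : R) x y,
            sU S (c *: x + y) = (fun t => c * sU S x t + sU S y t)
              %[ae smu S],
          forall x, ('N[smu S]_2%:E [EFin \o sU S x] = (`|x|)%:E)%E
        & forall h, h \in Lfun (smu S) 2%:E ->
            exists x, sU S x = h %[ae smu S]]] /\
  (forall x, DL x <-> (fun t => slam S t * sU S x t) \in Lfun (smu S) 2%:E) /\
  (forall x, DL x ->
     sU S (L x) = (fun t => slam S t * sU S x t) %[ae smu S]).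

(* y = L^nu x *)
Definition power_graph {R : realType} {X : completeNormedModType R}
    {d : measure_display} {T : measurableType d} (S : spectral_data X T)
    (nu : R) (x y : X) : Prop :=
  sU S y = (fun t => slam S t `^ nu * sU S x t) %[ae smu S].

(* The elements of X_nu that lie in X: all of X_nu if 0 <= nu, and the dense
   subspace X of the completion X_nu if nu < 0. *)
Definition hs_space {R : realType} {X : completeNormedModType R}
    {d : measure_display} {T : measurableType d} (S : spectral_data X T)
    (nu : R) : set X :=
  [set x | exists y, power_graph S nu x y].

Definition hs_power {R : realType} {X : completeNormedModType R}
    {d : measure_display} {T : measurableType d} (S : spectral_data X T)
    (nu : R) (x : X) : X :=
  xget 0 [set y | power_graph S nu x y].

(* Meaningful for x in [hs_space S nu] only. *)
Definition hs_norm {R : realType} {X : completeNormedModType R}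
    {d : measure_display} {T : measurableType d} (S : spectral_data X T)
    (nu : R) (x : X) : R := `|hs_power S nu x|.

Definition hs_enorm {R : realType} {X : completeNormedModType R}
    {d : measure_display} {T : measurableType d} (S : spectral_data X T)
    (nu : R) (x : X) : \bar R :=
  if `[< hs_space S nu x >] then (hs_norm S nu x)%:E else +oo%E.

(* The superscript is the index nu and the subscript the radius r. *)
Definition hs_ball {R : realType} {X : completeNormedModType R}
    {d : measure_display} {T : measurableType d} (S : spectral_data X T)
    (DF : set X) (nu r : R) (fbar : X) : set X :=
  [set f | [/\ hs_space S nu f, (hs_enorm S nu (f - fbar)%R <= r%:E)%E & DF f]].

(** ** The inverse problem *)

Definition unique_solution {R : realType} {X Y : completeNormedModType R}
    (DF : set X) (F : X -> Y) (fdag : X) (gdag : Y) : Prop :=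
  [/\ DF fdag, F fdag = gdag & forall f, DF f -> F f = gdag -> f = fdag].

Definition locally_ill_posed {R : realType} {X Y : completeNormedModType R}
    (DF : set X) (F : X -> Y) (fdag : X) : Prop :=
  forall r : R, 0 < r -> exists f_ : nat -> X,
    [/\ forall n, DF (f_ n) /\ `|f_ n - fdag| <= r,
        (0 < limn_einf (fun n => (`|f_ n - fdag|)%:E))%E
      & `|F (f_ n) - F fdag| @[n --> \oo] --> (0 : R)].

Definition basic_assumption {R : realType} {X Y : completeNormedModType R}
    (ipX : X -> X -> R) (ipY : Y -> Y -> R)
    {d : measure_display} {T : measurableType d} (S : spectral_data X T)
    (DF : set X) (F : X -> Y) (fdag : X) (gdag : Y) (a s u : R) : Prop :=
  [/\ convex_set (DF : set (convex_lmodType X)) /\ closed DF,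
      weak_to_weak_continuous ipX ipY DF F,
      [/\ 0 < u, hs_space S u fdag & unique_solution DF F fdag gdag]
    & [/\ 0 <= a, 0 <= s, s < u, u <= 2 * s + a & - a < s]].

Definition index_function {R : realType} (phi : R -> R) : Prop :=
  [/\ {within `[0, +oo[, continuous phi},
      forall x y, 0 <= x -> x < y -> phi x < phi y & phi 0 = 0].

Definition concave_on_nonneg {R : realType} (phi : R -> R) : Prop :=
  forall x y t, 0 <= x -> 0 <= y -> 0 <= t <= 1 ->
    t * phi x + (1 - t) * phi y <= phi (t * x + (1 - t) * y).

Definition conditional_stability {R : realType}
    {X Y : completeNormedModType R}
    {d : measure_display} {T : measurableType d} (S : spectral_data X T)
    (DF : set X) (F : X -> Y) (fdag : X) (a : R)
    (phi : R -> R) (theta0 rho0 R0 : R) (Q : set X) : Prop :=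
  [/\ index_function phi, concave_on_nonneg phi,
      [/\ 0 <= theta0, 0 < rho0 & 0 < R0],
      Q `<=` hs_ball S DF theta0 rho0 fdag
    & forall f, Q f -> (hs_enorm S (- a)%R (f - fdag)%R
        <= (R0 * phi `|F f - F fdag|)%:E)%E].

(** ** Noise *)

Definition gelfand_embedding {R : realType} {V Y : completeNormedModType R}
    (iota : {linear V -> Y}) : Prop :=
  [/\ continuous iota, injective iota & dense (range iota)].

(* The membership F f - gdag \in V, needed for its V-norm to make sense, is
   part of the inequality. *)
Definition stochastic_assumption {R : realType}
    {X Y V : completeNormedModType R} (ipV : V -> V -> R)
    (iota : {linear V -> Y})
    {d : measure_display} {T : measurableType d} (S : spectral_data X T)
    (DF : set X) (F : X -> Y) (fdag : X) (gdag : Y)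
    (s theta rho Ctheta : R) : Prop :=
  [/\ gelfand_embedding iota, hilbert_schmidt ipV iota,
      0 < rho, 0 < theta < 1
    & forall f, hs_ball S DF s rho fdag f ->
        exists2 v : V, iota v = F f - gdag
          & `|v| <= Ctheta * `|F f - gdag| `^ theta
                           * hs_norm S s (f - fdag) `^ (1 - theta)].

(* [Z g] is a representative of the random variable <Z, g>. *)
Definition hilbert_space_process {R : realType} {Y : completeNormedModType R}
    {d : measure_display} {Omega : measurableType d} (P : probability Omega R)
    (Z : Y -> Omega -> R) : Prop :=
  [/\ forall g, Z g \in Lfun P 2%:E,
      forall (c : R) g1 g2,
        Z (c *: g1 + g2) = (fun w => c * Z g1 w + Z g2 w) %[ae P]
    & exists K : R, forall g, ('N[P]_2%:E [EFin \o Z g] <= (K * `|g|)%:E)%E].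

Definition centered {R : realType} {Y : completeNormedModType R}
    {d : measure_display} {Omega : measurableType d} (P : probability Omega R)
    (Z : Y -> Omega -> R) : Prop :=
  forall g, ('E_P[Z g] = 0)%E.

Definition white {R : realType} {Y : completeNormedModType R}
    (ipY : Y -> Y -> R)
    {d : measure_display} {Omega : measurableType d} (P : probability Omega R)
    (Z : Y -> Omega -> R) : Prop :=
  forall g1 g2, covariance P (Z g1) (Z g2) = (ipY g1 g2)%:E.

(* Degenerate laws are Gaussian; they are treated apart because
   [normal_prob m 0] is not a Dirac mass. *)
Definition gaussian_rv {R : realType}
    {d : measure_display} {Omega : measurableType d} (P : probability Omega R)
    (X : Omega -> R) : Prop :=
  measurable_fun setT X /\
  ((exists m : R, X = cst m %[ae P]) \/
   (exists m sd : R, 0 < sd /\ forall A : set R, measurable A ->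
      P (X @^-1` A) = normal_prob m sd A)).

Definition gaussian_vector {R : realType}
    {d : measure_display} {Omega : measurableType d} (P : probability Omega R)
    (n : nat) (X : 'I_n -> Omega -> R) : Prop :=
  forall c : 'I_n -> R, gaussian_rv P (fun w => \sum_(i < n) c i * X i w).

Definition gaussian_process {R : realType} {Y : completeNormedModType R}
    {d : measure_display} {Omega : measurableType d} (P : probability Omega R)
    (Z : Y -> Omega -> R) : Prop :=
  forall (n : nat) (g : 'I_n -> Y), gaussian_vector P (fun i => Z (g i)).

(* The norm in V' of the functional v |-> z (iota v); +oo if unbounded. *)
Definition dual_norm {R : realType} {V Y : completeNormedModType R}
    (iota : V -> Y) (z : Y -> R) : \bar R :=
  ereal_sup [set (`|z (iota v)|)%:E | v in [set v : V | `|v| <= 1]].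

(* The representatives are chosen so that every path is a linear functional
   whose restriction to V almost surely belongs to V'. Such a choice exists:
   take on V the V'-valued random element defined by Z and extend it linearly
   along an algebraic complement of V in Y. *)
Definition pathwise_version {R : realType} {V Y : completeNormedModType R}
    (iota : V -> Y)
    {d : measure_display} {Omega : measurableType d} (P : probability Omega R)
    (Z : Y -> Omega -> R) : Prop :=
  (forall w (c : R) g1 g2, Z (c *: g1 + g2) w = c * Z g1 w + Z g2 w) /\
  {ae P, forall w, (dual_norm iota (fun g => Z g w) < +oo)%E}.

(* <g^obs, g>, where z is a path of Z *)
Definition observed {R : realType} {Y : completeNormedModType R}
    (ipY : Y -> Y -> R) (gdag xi : Y) (z : Y -> R) (sigma delta : R)
    (g : Y) : R :=
  ipY gdag g + delta * ipY g xi + sigma * z g.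

Definition tikhonov {R : realType} {X Y : completeNormedModType R}
    {d : measure_display} {T : measurableType d} (S : spectral_data X T)
    (F : X -> Y) (gobs : Y -> R) (s alpha : R) (f : X) : \bar R :=
  ((1 / 2 * `|F f| ^+ 2 - gobs (F f))%:E
   + alpha%:E * hs_enorm S s f ^+ 2)%E.

Definition argmin_on {R : realType} {X : Type} (D : set X) (J : X -> \bar R)
    : set X :=
  [set f | D f /\ forall f', D f' -> (J f <= J f')%E].

(** ** Fenchel conjugate *)

Definition fenchel_conjugate {R : realType} (h : R -> \bar R) (y : R)
    : \bar R :=
  ereal_sup [set ((x * y)%:E - h x)%E | x in [set: R]].

Definition psi_fun {R : realType} (phi : R -> R) (u s a t : R) : R :=
  phi (Num.sqrt t) `^ (2 * (u - s) / (a + u)).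

(* -psi, extended by +oo to negative arguments *)
Definition neg_psi {R : realType} (phi : R -> R) (u s a t : R) : \bar R :=
  if 0 <= t then (- psi_fun phi u s a t)%:E else +oo%E.

(* Main.v *)
Require Import Defs.
From HB Require Import structures.
From mathcomp Require Import all_boot all_order all_algebra.
From mathcomp Require Import all_classical all_reals all_analysis.
From mathcomp Require Import measurable_realfun ring lra.

Set Implicit Arguments.
Unset Strict Implicit.
Unset Printing Implicit Defensive.
Import Order.TTheory GRing.Theory Num.Theory.
Import numFieldNormedType.Exports.

Local Open Scope classical_set_scope.
Local Open Scope ring_scope.

(** Write e = f - fdag for the error of the minimizer f, E = |e|_s and
    D = |F f - gdag|. The estimate is deterministic: it holds along every path
    of the noise, with a constant that depends neither on the path nor on alpha.

    Comparing the Tikhonov functional at f and at fdag gives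
    ([tikhonov_basic_inequality])

      D^2 / 2 + alpha E^2 <= - 2 alpha <e, fdag>_s + delta <F f - gdag, xi>
                             + sigma <Z, F f - gdag>.

    The cross term is <L^(2s-u) e, L^u fdag>, and interpolation between X_(-a)
    and X_s bounds it by a multiple of |e|_(-a)^p E^(1-p) with
    p = (u - s) / (a + s) ([source_term_bound], which rests on
    [interpolation_inequality] and thus on Hoelder's inequality in the spectral
    representation). Conditional stability replaces |e|_(-a) by a multiple of
    phi(D). Young's inequality ([Young_powR]) splits the product
    into E^2 / 4 and a multiple of phi(D)^(2p/(1+p)); the exponent is
    2 (u - s) / (a + u), so this power is psi(D^2). The definition of the
    conjugate bounds psi(D^2) by (-psi)^*(-v) + v D^2 ([Fenchel_Young_psi]), and
    the slope v = 1 / (8 C alpha) is small enough to absorb the last term in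
    the left-hand side.

    The random noise is a duality pairing between V and its dual, so it is at
    most sigma |Z|_V' |F f - gdag|_V ([le_dual_norm]). The interpolation
    inequality of the stochastic assumption bounds the V-norm by a
    multiple of D^theta E^(1-theta), which is alpha^((theta-1)/2) times
    D^theta (sqrt alpha E)^(1-theta); the latter product is at most
    D + sqrt alpha E, and completing squares leaves
    sigma^2 |Z|_V'^2 alpha^(theta-1). All these absorptions are added up in
    [absorb_errors]. *)

(** * Real inner products *)

Section InnerProduct.
Context {R : realType} {X : completeNormedModType R} {ip : X -> X -> R}.
Context (hip : inner_product ip).

Lemma ipC x y : ip x y = ip y x.
Proof. by case: hip. Qed.

Lemma ip_norm x : ip x x = `|x| ^+ 2.
Proof. by case: hip. Qed.

Lemma ipDl x y z : ip (x + y) z = ip x z + ip y z.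
Proof. by case: hip => _ /(_ 1 x y z) + _; rewrite scale1r mul1r. Qed.

Lemma ip0l z : ip 0 z = 0.
Proof. by apply: (addrI (ip 0 z)); rewrite -ipDl !addr0. Qed.

Lemma ipZl c x z : ip (c *: x) z = c * ip x z.
Proof. by case: hip => _ /(_ c x 0 z) + _; rewrite !addr0 ip0l addr0. Qed.

Lemma ipBl x y z : ip (x - y) z = ip x z - ip y z.
Proof. by rewrite ipDl -scaleN1r ipZl mulN1r. Qed.

Lemma ipBr x y z : ip z (x - y) = ip z x - ip z y.
Proof. by rewrite ipC ipBl !(ipC z). Qed.

Lemma normB_sqr x y : `|x - y| ^+ 2 = `|x| ^+ 2 - 2 * ip x y + `|y| ^+ 2.
Proof. by rewrite -!ip_norm ipBl !ipBr (ipC y x); ring. Qed.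

Lemma cauchy_schwarz x y : `|ip x y| <= `|x| * `|y|.
Proof.
have [->|y0] := eqVneq y 0; first by rewrite ipC ip0l !normr0 mulr0.
have Y0 : 0 < `|y| by rewrite normr_gt0.
have [->|x0] := eqVneq x 0; first by rewrite ip0l !normr0 mul0r.
have X0 : 0 < `|x| by rewrite normr_gt0.
(* the vectors are rescaled to the common length |x||y|; the sign c covers
   both bounds on the absolute value *)
have h (c : R) : c ^+ 2 = 1 -> c * ip x y <= `|x| * `|y|.
  move=> c1; have := sqr_ge0 `| (c * `|y|) *: x - `|x| *: y |.
  rewrite normB_sqr !normrZ !normr_id ipZl (ipC x) ipZl (ipC y) => h.
  rewrite 3!exprMn real_normK ?num_real// c1 mul1r in h.
  have {}h : 0 <= (`|x| * `|y|) * (`|x| * `|y| - c * ip x y) by nra.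
  by rewrite pmulr_rge0 ?mulr_gt0// subr_ge0 in h.
rewrite ler_norml lerNl -mulN1r !h ?sqrrN ?expr1n//.
by rewrite -[leLHS]mul1r h ?expr1n.
Qed.

End InnerProduct.

(** * Integrals of real functions *)

Section MeasureIntegral.
Context {d : measure_display} {T : measurableType d} {R : realType}.
Context (mu : {measure set T -> \bar R}).

Lemma ae_eq_Rintegral (f g : T -> R) :
  measurable_fun setT f -> measurable_fun setT g ->
  f = g %[ae mu] -> \int[mu]_t f t = \int[mu]_t g t.
Proof.
move=> mf mg fg; congr fine; apply: ae_eq_integral => //.
- exact/measurable_EFinP.
- exact/measurable_EFinP.
- by apply: filterS fg => t /(_ I) -> _.
Qed.

(** Hoelder's inequality for the functions f^p and g^(1-p) with the conjugate
    exponents 1/p and 1/(1-p): a weighted geometric mean of two densities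
    integrates to at most the geometric mean of their integrals. This form is
    the one that yields interpolation in the Hilbert scale. *)
Lemma Rintegral_Hoelder (f g : T -> R) (p : R) : 0 < p < 1 ->
  (forall t, 0 <= f t) -> (forall t, 0 <= g t) ->
  mu.-integrable setT (EFin \o f) -> mu.-integrable setT (EFin \o g) ->
  \int[mu]_t (f t `^ p * g t `^ (1 - p)) <=
    (\int[mu]_t f t) `^ p * (\int[mu]_t g t) `^ (1 - p).
Proof.
move=> /andP[p0 p1] f0 g0 intf intg.
have mf : measurable_fun setT f by move/integrableP: intf => [/measurable_EFinP].
have mg : measurable_fun setT g by move/integrableP: intg => [/measurable_EFinP].
have mpow (h : T -> R) r : measurable_fun setT h ->
    measurable_fun setT (fun t => h t `^ r).
  exact: (@measurableT_comp _ _ _ _ _ _ (@powR R ^~ r)).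
have q0 : 0 < 1 - p by rewrite subr_gt0.
have fin (h : T -> R) : mu.-integrable setT (EFin \o h) ->
    (\int[mu]_t (h t)%:E)%E = (\int[mu]_t h t)%:E.
  by move=> ih; rewrite fineK//; exact: integrable_fin_num.
have LN (h : T -> R) r : 0 < r -> (forall t, 0 <= h t) ->
    mu.-integrable setT (EFin \o h) ->
    ('N[mu]_(r^-1)%:E [EFin \o (fun t => (h t `^ r)%R)] =
       ((\int[mu]_t h t)%R `^ r)%R%:E)%E.
  move=> r0 h0 ih; rewrite unlock /Lnorm invrK -poweR_EFin -fin//.
  congr (_ `^ _)%E; apply: eq_integral => t _ /=.
  by rewrite ger0_norm ?powR_ge0// -powRrM mulfV ?gt_eqF// powRr1.
have := @hoelder _ _ _ mu (fun t => f t `^ p) (fun t => g t `^ (1 - p))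
  p^-1 (1 - p)^-1.
rewrite !invr_gt0 !invrK (addrC p) subrK !LN// => /(_ (mpow _ _ mf) (mpow _ _ mg)).
move=> /(_ p0 q0 erefl); rewrite Lnorm1 -EFinM.
rewrite (_ : (\int[mu]_t _)%E =
    (\int[mu]_t (f t `^ p * g t `^ (1 - p))%:E)%E); last first.
  by apply: eq_integral => t _ /=; rewrite ger0_norm// mulr_ge0// powR_ge0.
move=> H; rewrite -lee_fin fineK// ge0_fin_numE.
  exact: le_lt_trans H (ltry _).
by apply: integral_ge0 => t _; rewrite lee_fin mulr_ge0// powR_ge0.
Qed.

End MeasureIntegral.

(** * The spectral representation as an isometry *)

Section Spectral.
Context {R : realType} {X : completeNormedModType R} {ip : X -> X -> R}.
Context (hip : inner_product ip).
Context {d : measure_display} {T : measurableType d} {S : spectral_data X T}.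
Context {DL : set X} {L : X -> X} (hS : diagonalizes S DL L).

Let mu : {measure set T -> \bar R} := smu S.

Lemma slam_gt0 t : 0 < slam S t.
Proof. by case: hS => -[]. Qed.

Lemma measurable_slam : measurable_fun setT (slam S).
Proof. by case: hS => -[]. Qed.

Lemma sU_Lfun2 x : sU S x \in Lfun mu 2%:E.
Proof. by case: hS => -[_ _ []]. Qed.

Lemma measurable_sU x : measurable_fun setT (sU S x).
Proof. by have := sub_Lfun_mfun (sU_Lfun2 x); rewrite inE. Qed.

Lemma sU_linear (c : R) x y :
  sU S (c *: x + y) = (fun t => c * sU S x t + sU S y t) %[ae mu].
Proof. by case: hS => -[_ _ []]. Qed.

Lemma sU_sub x y : sU S (x - y) = (fun t => sU S x t - sU S y t) %[ae mu].
Proof.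
rewrite addrC -scaleN1r; apply: filterS (sU_linear (-1) y x) => t /[apply] ->.
by rewrite mulN1r addrC.
Qed.

Lemma integrable_sU_mul x y :
  mu.-integrable setT (EFin \o (fun t => sU S x t * sU S y t)).
Proof. by apply/Lfun1_integrable/Lfun2_mul_Lfun1; exact: sU_Lfun2. Qed.

Lemma sU_norm x : `|x| ^+ 2 = \int[mu]_t (sU S x t * sU S x t).
Proof.
have [_ _ [_ _ /(_ x) hN _]] := hS.1.
have := powR_Lnorm (smu S) (EFin \o sU S x) (ltac:(by []) : (2 : R) != 0).
rewrite hN poweR_EFin powR_mulrn// => h.
rewrite /Rintegral -[LHS]/(fine (`|x| ^+ 2)%:E) h; congr fine.
apply: eq_integral => t _ /=.
by rewrite powR_mulrn// real_normK ?num_real.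
Qed.

(** A real inner product is determined by its norm (here through |x - y|^2), so
    the isometry sU onto L^2, defined only up to null sets, carries it to the
    L^2 inner product. *)
Lemma ip_sU x y : ip x y = \int[mu]_t (sU S x t * sU S y t).
Proof.
have := normB_sqr hip x y; rewrite !sU_norm.
rewrite (@ae_eq_Rintegral _ _ _ _ _ (fun t => sU S x t * sU S x t -
    2 * (sU S x t * sU S y t) + sU S y t * sU S y t)).
- have i2 : mu.-integrable setT
      (EFin \o (fun t => 2 * (sU S x t * sU S y t))).
    by have := integrableZl measurableT 2 (integrable_sU_mul x y).
  rewrite RintegralD ?RintegralB ?RintegralZl//;
    try exact: integrable_sU_mul; last first.
    have := integrableB measurableT (integrable_sU_mul x x) i2.
    by apply: eq_integrable.
  lra.
- by apply: measurable_funM; exact: measurable_sU.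
- by do ?[apply: measurable_funB|apply: measurable_funD|apply: measurable_funM];
    solve [exact: measurable_sU|exact: measurable_cst].
- by apply: filterS (sU_sub x y) => t /[apply] ->; ring.
Qed.

Lemma sU_inj x y : sU S x = sU S y %[ae mu] -> x = y.
Proof.
move=> xy; apply/eqP; rewrite -subr_eq0 -normr_eq0 -sqrf_eq0 sU_norm; apply/eqP.
rewrite (@ae_eq_Rintegral _ _ _ _ _ (fun t => 0)).
- by rewrite /Rintegral integral0.
- by apply: measurable_funM; exact: measurable_sU.
- exact: measurable_cst.
- by apply: filterS2 (sU_sub x y) xy => t h1 h2 I; rewrite h1// h2// subrr mulr0.
Qed.

End Spectral.

(** * Powers of the generator and interpolation *)

Section Scale.
Context {R : realType} {X : completeNormedModType R} {ip : X -> X -> R}.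
Context (hip : inner_product ip).
Context {d : measure_display} {T : measurableType d} {S : spectral_data X T}.
Context {DL : set X} {L : X -> X} (hS : diagonalizes S DL L).

Let mu : {measure set T -> \bar R} := smu S.
Let lam_gt0 := slam_gt0 hS.
Let mU := measurable_sU hS.

Lemma slam_powRD nu nu' t :
  slam S t `^ (nu + nu') = slam S t `^ nu * slam S t `^ nu'.
Proof. by rewrite powRD// (gt_eqF (lam_gt0 t)) implybT. Qed.

Lemma measurable_slam_powR nu : measurable_fun setT (fun t => slam S t `^ nu).
Proof.
apply: (@measurableT_comp _ _ _ _ _ _ (@powR R ^~ nu)) => //.
exact: measurable_slam hS.
Qed.

(** The representation sU is injective, which makes L^nu x a single vector; the
    choice in [hs_power] then has only one candidate. *)
Lemma power_graph_unique nu x y y' :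
  power_graph S nu x y -> power_graph S nu x y' -> y = y'.
Proof.
move=> h h'; apply: (sU_inj hS).
by apply: filterS2 h h' => t h h' I; rewrite h// h'.
Qed.

Lemma hs_powerE nu x y : power_graph S nu x y -> hs_power S nu x = y.
Proof.
by move=> h; rewrite /hs_power; case: xgetP => [z _ /power_graph_unique /(_ h)|/(_ y)].
Qed.

Lemma hs_normE nu x y : power_graph S nu x y -> hs_norm S nu x = `|y|.
Proof. by rewrite /hs_norm => /hs_powerE->. Qed.

Lemma hs_enormE nu x y : power_graph S nu x y -> hs_enorm S nu x = (`|y|)%:E.
Proof.
by move=> h; rewrite /hs_enorm (hs_normE h) asboolT//; exists y.
Qed.

Lemma power_graphB nu x y x' y' :
  power_graph S nu x x' -> power_graph S nu y y' ->
  power_graph S nu (x - y) (x' - y').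
Proof.
move=> hx hy.
have e : sU S (x' - y') =
    (fun t => slam S t `^ nu * (sU S x t - sU S y t)) %[ae mu].
  apply: filterS3 (sU_sub hS x' y') hx hy => t h1 h2 h3 I.
  by rewrite h1// h2// h3// mulrBr.
by apply: filterS2 (sU_sub hS x y) e => t h1 h2 I; rewrite h1// h2.
Qed.

(** Since the spectral function is positive, its powers can be divided out, and
    no domain question arises: L^(nu' - nu) is applied to the vector L^nu x,
    whose image L^nu' x is known to exist. *)
Lemma power_graph_quotient nu nu' x y z :
  power_graph S nu x y -> power_graph S nu' x z -> power_graph S (nu' - nu) y z.
Proof.
by apply: filterS2 => t hy hz I; rewrite hy// hz// mulrA -slam_powRD subrK.
Qed.

(** Self-adjointness of the scale: a power of L moves from one factor of an
    inner product to the other, because on the spectral side both sides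
    integrate the same product. *)
Lemma ip_power nu x y x' y' :
  power_graph S nu x x' -> power_graph S (- nu) y y' -> ip x y = ip x' y'.
Proof.
move=> hx hy; rewrite !(ip_sU hip hS); apply: ae_eq_Rintegral.
- by apply: measurable_funM; exact: mU.
- by apply: measurable_funM; exact: mU.
- apply: filterS2 hx hy => t hx hy I; rewrite hx// hy//.
  by rewrite mulrACA -slam_powRD subrr powRr0 mul1r.
Qed.

Lemma power_graph_sqr nu x y : power_graph S nu x y ->
  `|y| ^+ 2 = \int[mu]_t (slam S t `^ (2 * nu) * sU S x t ^+ 2).
Proof.
move=> h; rewrite (sU_norm hS); apply: ae_eq_Rintegral.
- by apply: measurable_funM; exact: mU.
- apply: measurable_funM; first exact: measurable_slam_powR.
  by apply: measurable_funX; exact: mU.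
- apply: filterS h => t /[apply] ->.
  by rewrite (mulrC 2 nu) powRrM powR_mulrn ?powR_ge0//; ring.
Qed.

Lemma integrable_power nu x y : power_graph S nu x y ->
  mu.-integrable setT
    (EFin \o (fun t => slam S t `^ (2 * nu) * sU S x t ^+ 2)).
Proof.
move=> h.
have mf : measurable_fun setT
    (EFin \o (fun t => slam S t `^ (2 * nu) * sU S x t ^+ 2)).
  apply/measurable_EFinP/measurable_funM; first exact: measurable_slam_powR.
  by apply: measurable_funX; exact: mU.
have /integrableP[mi fi] := integrable_sU_mul hS y y.
apply/integrableP; split => //.
rewrite (ae_eq_integral (fun t => `|(sU S y t * sU S y t)%:E|)%E)//.
- exact: measurableT_comp.
- exact: measurableT_comp.
- apply: filterS h => t /[apply] /= ->.
  by congr (`|_|%:E); rewrite (mulrC 2 nu) powRrM powR_mulrn ?powR_ge0//; ring.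
Qed.

(** For nu between nu1 and nu2, lam^nu is at most lam^nu2 where lam >= 1 and at
    most lam^nu1 where lam < 1. Hence lam^nu * sU x is square-integrable, and
    surjectivity of sU onto L^2 provides L^nu x. *)
Lemma hs_space_between nu1 nu nu2 x : nu1 <= nu <= nu2 ->
  hs_space S nu1 x -> hs_space S nu2 x -> hs_space S nu x.
Proof.
move=> /andP[nu1nu nunu2] [y1 h1] [y2 h2].
have [_ _ [_ _ _ onto]] := hS.1.
apply: (onto (fun t => slam S t `^ nu * sU S x t)).
have m1 : measurable_fun setT (fun t => slam S t `^ nu * sU S x t).
  by apply: measurable_funM; [exact: measurable_slam_powR|exact: mU].
have mi := integrableD measurableT (integrable_power h1) (integrable_power h2).
rewrite inE; apply/andP; split; rewrite inE//= /finite_norm.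
rewrite unlock /Lnorm poweR_lty//.
have /integrableP[mI fi] := mi.
apply: le_lt_trans fi; apply: ge0_le_integral => //.
- by move=> t _; exact: poweR_ge0.
- apply: (measurableT_comp (measurable_poweR _)) => //.
  by do 2 apply: measurableT_comp => //.
- exact: measurableT_comp.
- move=> t _ /=.
  rewrite lee_fin [leRHS]ger0_norm; last first.
    by rewrite addr_ge0// mulr_ge0// ?powR_ge0// sqr_ge0.
  rewrite powR_mulrn// real_normK ?num_real// exprMn -mulrDl ler_wpM2r ?sqr_ge0//.
  rewrite -powR_mulrn ?powR_ge0// -powRrM mulrC.
  have [l1|l1] := leP 1 (slam S t).
    apply: (@le_trans _ _ (slam S t `^ (2 * nu2))).
      by apply: ler_powR => //; lra.
    by rewrite lerDr powR_ge0.
  apply: (@le_trans _ _ (slam S t `^ (2 * nu1))).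
    by apply: ger_powR; [rewrite lam_gt0 ltW|lra].
  by rewrite lerDl powR_ge0.
Qed.

Lemma power_graph0 x : power_graph S 0 x x.
Proof. by apply/aeW => t _; rewrite powRr0 mul1r. Qed.

(** The density of |L^nu x|^2 at nu = p nu1 + (1 - p) nu2 is the weighted
    geometric mean of the densities at nu1 and nu2, so that
    [Rintegral_Hoelder] applies; for p = 1 the conjugate exponent
    1/(1-p) is lost, but then nu = nu1. *)
Lemma interpolation_inequality nu1 nu2 p x x1 x0 x2 :
  0 < p <= 1 ->
  power_graph S nu1 x x1 -> power_graph S (p * nu1 + (1 - p) * nu2) x x0 ->
  power_graph S nu2 x x2 ->
  `|x0| <= `|x1| `^ p * `|x2| `^ (1 - p).
Proof.
move=> /andP[p0]; rewrite le_eqVlt => /predU1P[->|p1] h1 h0 h2.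
  move: h0; rewrite mul1r subrr mul0r addr0 => h0.
  by rewrite (power_graph_unique h0 h1) powRr1// powRr0 mulr1.
have q0 : 0 < 1 - p by rewrite subr_gt0.
have pq : p + (1 - p) = 1 by ring.
have powpq (z : R) : 0 <= z -> z `^ p * z `^ (1 - p) = z.
  by move=> z0; rewrite -powRD pq ?powRr1// oner_eq0.
have := @Rintegral_Hoelder _ _ _ mu _ _ p _ _ _
  (integrable_power h1) (integrable_power h2).
rewrite p0 p1 -(power_graph_sqr h1) -(power_graph_sqr h2) => /(_ isT).
move=> /(_ (fun t => mulr_ge0 (powR_ge0 _ _) (sqr_ge0 _))).
move=> /(_ (fun t => mulr_ge0 (powR_ge0 _ _) (sqr_ge0 _))).
rewrite (_ : \int[mu]_t _ = `|x0| ^+ 2); last first.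
  rewrite (power_graph_sqr h0); apply: eq_Rintegral => t _.
  rewrite /= !(powRM _ (powR_ge0 _ _) (sqr_ge0 _)) mulrACA.
  rewrite powpq ?sqr_ge0//; congr (_ * _).
  by rewrite -!powRrM -slam_powRD; congr (slam S t `^ _); ring.
rewrite -!powR_mulrn// -!powRrM ![2 * _]mulrC !powRrM -powRM ?powR_ge0//.
by apply: contraTT; rewrite -!ltNge => h; apply: gt0_ltr_powR;
  rewrite ?nnegrE ?mulr_ge0 ?powR_ge0.
Qed.

End Scale.

(** * Young-type inequalities *)

(** Young's inequality with a prescribed constant eps in front of y^2. Either
    c x <= eps y^(2-q), and the first summand alone dominates, or y is bounded
    by a multiple of x^(1/(2-q)), and the second one does. *)
Lemma Young_powR (R : realType) (c eps q : R) : 0 <= c -> 0 < eps -> 0 <= q < 2 ->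
  exists2 K, 0 <= K & forall x y, 0 <= x -> 0 <= y ->
    c * x * y `^ q <= eps * y ^+ 2 + K * x `^ (2 / (2 - q)).
Proof.
move=> c0 e0 /andP[q0 q2].
have r0 : 0 < 2 - q by lra.
have K0 : 0 <= c * (c / eps) `^ (q / (2 - q)) by rewrite mulr_ge0// powR_ge0.
exists (c * (c / eps) `^ (q / (2 - q))) => // x y x0 y0.
have [h|h] := leP (c * x) (eps * y `^ (2 - q)).
  have -> : y ^+ 2 = y `^ (2 - q) * y `^ q.
    by rewrite -powRD subrK ?powR_mulrn// pnatr_eq0.
  rewrite mulrA -[leLHS]addr0 lerD ?mulr_ge0 ?powR_ge0//.
  by rewrite ler_wpM2r// powR_ge0.
have {}h : y <= (c * x / eps) `^ (2 - q)^-1.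
  rewrite [leLHS](_ : y = (y `^ (2 - q)) `^ (2 - q)^-1); last first.
    by rewrite -powRrM mulfV ?lt0r_neq0// powRr1.
  apply: ge0_ler_powR; rewrite ?nnegrE ?powR_ge0 ?invr_ge0 ?divr_ge0 ?mulr_ge0//.
  - exact: ltW.
  - exact: ltW.
  - by rewrite ler_pdivlMr// mulrC ltW.
have {}h : y `^ q <= (c / eps) `^ (q / (2 - q)) * x `^ (q / (2 - q)).
  rewrite -powRM ?divr_ge0 ?(ltW e0)// mulrAC (mulrC q) powRrM.
  by apply: ge0_ler_powR => //; rewrite nnegrE ?powR_ge0.
apply: (@le_trans _ _ (c * (c / eps) `^ (q / (2 - q)) * x `^ (2 / (2 - q)))).
  rewrite (_ : 2 / (2 - q) = 1 + q / (2 - q)); last by field; lra.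
  have [->|xn0] := eqVneq x 0.
    by rewrite mulr0 mul0r mulr_ge0// powR_ge0.
  rewrite powRD ?xn0 ?implybT// powRr1//.
  rewrite [leRHS](_ : _ =
    c * x * ((c / eps) `^ (q / (2 - q)) * x `^ (q / (2 - q)))); last by ring.
  by rewrite ler_wpM2l// mulr_ge0.
by rewrite lerDr mulr_ge0 ?sqr_ge0// ltW.
Qed.

(** No factor decreases when its base is replaced by x + y, and the exponents
    th and 1 - th then add up to 1. *)
Lemma geometric_mean_le_sum (R : realType) (th x y : R) : 0 <= th <= 1 ->
  0 <= x -> 0 <= y -> x `^ th * y `^ (1 - th) <= x + y.
Proof.
move=> /andP[th0 th1] x0 y0; set m := x + y.
have m0 : 0 <= m by rewrite addr_ge0.
have -> : m = m `^ th * m `^ (1 - th).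
  by rewrite -powRD addrC subrK ?powRr1// oner_eq0.
apply: ler_pM; rewrite ?powR_ge0//; apply: ge0_ler_powR;
  by rewrite ?nnegrE ?subr_ge0// ?lerDl ?lerDr.
Qed.

(** * Duality *)

Section DualNorm.
Context {R : realType} {V Y : completeNormedModType R} {iota : {linear V -> Y}}.
Context {z : Y -> R}.

Lemma dual_norm_ge0 : (0 <= dual_norm iota z)%E.
Proof.
apply: (@le_trans _ _ (`|z (iota 0)|)%:E); first by rewrite lee_fin.
by apply: ereal_sup_ubound; exists 0 => //=; rewrite normr0.
Qed.

(** The supremum in [dual_norm] runs over the unit ball; rescaling v gives the
    duality bound for every v. When the dual norm is infinite and v = 0, the
    product +oo * 0 = 0 is the correct bound, since z 0 = 0. *)
Lemma le_dual_norm v :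
  (forall (c : R) g1 g2, z (c *: g1 + g2) = c * z g1 + z g2) ->
  ((`|z (iota v)|)%:E <= dual_norm iota z * (`|v|)%:E)%E.
Proof.
move=> zl.
have z0 : z 0 = 0.
  by have := zl 1 0 0; rewrite scale1r addr0 mul1r => h; lra.
have zZ c g : z (c *: g) = c * z g by rewrite -[c *: g]addr0 zl z0 addr0.
have [->|v0] := eqVneq v 0; first by rewrite linear0 z0 !normr0 mule0.
have vgt0 : 0 < `|v| by rewrite normr_gt0.
rewrite -lee_pdivrMr// -EFinM.
apply: ereal_sup_ubound; exists (`|v|^-1 *: v) => /=.
  by rewrite normrZ normfV normr_id mulVf ?gt_eqF.
by rewrite linearZ/= zZ normrM normfV normr_id mulrC.
Qed.

End DualNorm.

Lemma Fenchel_Young_psi (R : realType) (phi : R -> R) (u s a t y : R) : 0 <= t ->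
  ((psi_fun phi u s a t + t * y)%:E <= fenchel_conjugate (neg_psi phi u s a) y)%E.
Proof.
move=> t0; apply: ereal_sup_ubound; exists t => //.
by rewrite /neg_psi t0 -EFinB opprK addrC.
Qed.

(** * The Tikhonov minimizer *)

Section Tikhonov.
Context {R : realType} {X Y : completeNormedModType R}.
Context {ipX : X -> X -> R} {ipY : Y -> Y -> R}.
Context (hipX : inner_product ipX) (hipY : inner_product ipY).
Context {d : measure_display} {T : measurableType d} {S : spectral_data X T}.
Context {DL : set X} {L : X -> X} (hS : diagonalizes S DL L).

(** Comparison of the functional at the minimizer f and at fdag. Expanding both
    quadratic terms around fdag turns the data misfit into
    |F f - F fdag|^2 / 2 and the penalty into |f - fdag|_s^2, at the price of
    the cross term -2 <f - fdag, fdag>_s. Linearity of the noise path z on all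
    of Y lets the noise act on the difference F f - F fdag. *)
Lemma tikhonov_basic_inequality (DF : set X) (F : X -> Y) (xi : Y)
    (z : Y -> R) (sigma delta s alpha : R) (f fdag fs ds : X) :
  (forall (c : R) g1 g2, z (c *: g1 + g2) = c * z g1 + z g2) ->
  power_graph S s f fs -> power_graph S s fdag ds -> DF fdag ->
  argmin_on DF
    (tikhonov S F (observed ipY (F fdag) xi z sigma delta) s alpha) f ->
  1 / 2 * `|F f - F fdag| ^+ 2 + alpha * `|fs - ds| ^+ 2 <=
    alpha * - (2 * ipX (fs - ds) ds) + delta * ipY (F f - F fdag) xi
    + sigma * z (F f - F fdag).
Proof.
move=> zl hf hd Dd [_ /(_ _ Dd)].
rewrite /tikhonov (hs_enormE hS hf) (hs_enormE hS hd) -!EFin_expe -!EFinM.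
rewrite -!EFinD lee_fin /observed.
have -> : z (F f - F fdag) = z (F f) - z (F fdag).
  by rewrite addrC -scaleN1r zl; ring.
rewrite !(normB_sqr hipX) !(normB_sqr hipY) !(ipBl hipX) !(ipBl hipY).
rewrite (ip_norm hipX) (ip_norm hipY) (ipC hipY (F f) (F fdag)).
nra.
Qed.

(** The smoothness fdag in X_u is spent here: moving L^(u-s) to the side of
    fdag gives <e, fdag>_s = <L^(2s-u) e, L^u fdag>. The index 2s - u lies in
    [-a, s[ because s < u <= 2s + a, and it divides that interval with weight
    (u - s) / (a + s) on -a, so the weak norm of e, which conditional stability
    controls, enters by interpolation. *)
Lemma source_term_bound (a s u : R) (e es ea ds fdag du : X) :
  - a < s -> s < u -> u <= 2 * s + a ->
  power_graph S s e es -> power_graph S (- a) e ea ->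
  power_graph S s fdag ds -> power_graph S u fdag du ->
  `|ipX es ds| <= `|du| * (`|ea| `^ ((u - s) / (a + s))
                        * `|es| `^ (1 - (u - s) / (a + s))).
Proof.
move=> as0 su usa hs ha hd hdu.
have as_gt0 : 0 < a + s by lra.
have [em hm] : hs_space S (2 * s - u) e.
  apply: (hs_space_between hS (nu1 := - a) (nu2 := s)); first by lra.
    by exists ea.
  by exists es.
have hes : power_graph S (s - u) es em.
  have := power_graph_quotient hS hs hm.
  by rewrite (_ : 2 * s - u - s = s - u); last ring.
have hds : power_graph S (- (s - u)) ds du.
  by rewrite opprB; exact: (power_graph_quotient hS hd hdu).
rewrite (ip_power hipX hS hes hds).
apply: le_trans (cauchy_schwarz hipX _ _) _.
rewrite mulrC ler_wpM2l//.
have p01 : 0 < (u - s) / (a + s) <= 1.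
  by rewrite divr_gt0 ?subr_gt0//= ler_pdivrMr// mul1r; lra.
apply: (interpolation_inequality hS p01 ha _ hs).
rewrite (_ : _ + _ = 2 * s - u)//; field; lra.
Qed.

End Tikhonov.

(** * The error estimate *)

(** The budget of the final estimate. Of the terms D^2 / 2 + al E^2 given by
    minimality, the cross term al G uses al E^2 / 4 and, after the Fenchel
    inequality at slope 1 / (8 C al), D^2 / 8; the deterministic noise
    uses D^2 / 8; the random noise uses D^2 / 8 + al E^2 / 4. What remains
    is at least D^2 / 8 + al E^2 / 4. Here kappa = sqrt al * E puts D and E on the
    same scale. *)
Lemma absorb_errors (R : realType)
    (C al D E G psi conj n m N dl dD K kappa : R) :
  0 < al -> 0 <= K -> 0 <= conj ->
  K + 2 <= C -> 3 * n ^+ 2 <= C * m -> kappa = Num.sqrt al * E ->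
  1 / 2 * D ^+ 2 + al * E ^+ 2 <= al * G + dD + N ->
  G <= 1 / 4 * E ^+ 2 + K * psi ->
  psi + D ^+ 2 * - (1 / (8 * C * al)) <= conj ->
  dD <= dl * D -> N <= n * (D + kappa) ->
  1 / 8 * D ^+ 2 + al / 4 * E ^+ 2 <= C * (m + dl ^+ 2 + al * conj).
Proof.
move=> al0 K0 conj0 KC nm kE basic hG hpsi hdD hN.
have C0 : 0 < C by lra.
have k2 : kappa ^+ 2 = al * E ^+ 2 by rewrite kE exprMn sqr_sqrtr ?ltW.
have {}hpsi : K * (al * psi) <= C * (al * conj) + 1 / 8 * D ^+ 2.
  have h1 : al * psi <= al * conj + 1 / (8 * C) * D ^+ 2.
    have := ler_wpM2l (ltW al0) hpsi; rewrite mulrDr.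
    rewrite (_ : al * (D ^+ 2 * _) = - (1 / (8 * C) * D ^+ 2)); first by lra.
    by field; rewrite !gt_eqF.
  have v0 : 0 <= 1 / (8 * C) * D ^+ 2.
    by rewrite mulr_ge0 ?sqr_ge0// divr_ge0// mulr_ge0// ltW.
  apply: (le_trans (ler_wpM2l K0 h1)).
  (* K is enlarged to C so that the slope 1 / (8 C al) leaves D^2 / 8 *)
  apply: (@le_trans _ _ (C * (al * conj + 1 / (8 * C) * D ^+ 2))).
    by apply: ler_wpM2r; [rewrite addr_ge0// mulr_ge0// ltW|lra].
  rewrite le_eqVlt; apply/orP; left; apply/eqP; field; rewrite gt_eqF//.
have {}hG : al * G <= 1 / 4 * kappa ^+ 2 + K * (al * psi).
  by rewrite k2; have := ler_wpM2l (ltW al0) hG; nra.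
have hdl : dl * D <= 1 / 8 * D ^+ 2 + 2 * dl ^+ 2.
  by have := sqr_ge0 (D - 4 * dl); nra.
have hn : n * (D + kappa) <= 1 / 8 * D ^+ 2 + 1 / 4 * kappa ^+ 2 + 3 * n ^+ 2.
  by have := sqr_ge0 (D - 4 * n); have := sqr_ge0 (kappa - 2 * n); nra.
have hd2 : 2 * dl ^+ 2 <= C * dl ^+ 2 by rewrite ler_wpM2r ?sqr_ge0//; lra.
have k20 := sqr_ge0 kappa.
rewrite -k2 in basic; rewrite !mulrDr.
have -> : al / 4 * E ^+ 2 = 1 / 4 * kappa ^+ 2 by rewrite k2; ring.
lra.
Qed.

Theorem theorem2 (R : realType) (X Y V : completeNormedModType R)
  (ipX : X -> X -> R) (ipY : Y -> Y -> R) (ipV : V -> V -> R)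
  (hipX : inner_product ipX) (hipY : inner_product ipY)
  (hipV : inner_product ipV)
  (hXdim : infinite_dimensional X) (hXsep : separable X)
  (hYdim : infinite_dimensional Y) (hYsep : separable Y)
  (* the generator of the Hilbert scale and its spectral representation *)
  (DL : set X) (L : X -> X) (hL : scale_generator ipX DL L)
  (dT : measure_display) (T : measurableType dT) (S : spectral_data X T)
  (hS : diagonalizes S DL L)
  (* the inverse problem *)
  (DF : set X) (F : X -> Y) (fdag : X) (gdag : Y) (a s u : R)
  (hill : locally_ill_posed DF F fdag)
  (hbasic : basic_assumption ipX ipY S DF F fdag gdag a s u)
  (phi : R -> R) (theta0 rho0 R0 : R) (Q : set X)
  (hstab : conditional_stability S DF F fdag a phi theta0 rho0 R0 Q)
  (iota : {linear V -> Y}) (theta rho Ctheta : R)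
  (hstoch : stochastic_assumption ipV iota S DF F fdag gdag
              s theta rho Ctheta)
  (* the noise *)
  (dO : measure_display) (Omega : measurableType dO)
  (P : probability Omega R) (Z : Y -> Omega -> R)
  (hZ : hilbert_space_process P Z) (hZc : centered P Z)
  (hZw : white ipY P Z) (hZg : gaussian_process P Z)
  (hZv : pathwise_version iota P Z) :
  exists C : R, 0 < C /\
    forall (w : Omega) (xi : Y) (sigma0 delta0 : R)
      (alpha : R -> R -> R) (fhat : R -> R -> X),
      `|xi| <= 1 -> 0 < sigma0 -> 0 < delta0 ->
      (forall sigma delta,
         0 < sigma <= sigma0 -> 0 < delta <= delta0 ->
         [/\ 0 < alpha sigma delta,
             argmin_on DF
               (tikhonov S F
                  (observed ipY gdag xi (fun g => Z g w) sigma delta)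
                  s (alpha sigma delta)) (fhat sigma delta),
             hs_ball S DF s rho fdag (fhat sigma delta)
           & Q (fhat sigma delta)]) ->
      forall sigma delta,
        0 < sigma <= sigma0 -> 0 < delta <= delta0 ->
        ((1 / 8 * `|F (fhat sigma delta) - gdag| ^+ 2)%:E
         + (alpha sigma delta / 4)%:E
           * hs_enorm S s (fhat sigma delta - fdag)%R ^+ 2
         <= C%:E *
            ((sigma ^+ 2)%:E * dual_norm iota (fun g => Z g w) ^+ 2
               * (alpha sigma delta `^ (theta - 1))%:E
             + (delta ^+ 2)%:E
             + (alpha sigma delta)%:E
               * fenchel_conjugate (neg_psi phi u s a)
                   (- (1 / (8 * C * alpha sigma delta)))%R))%E.
Proof.
have [_ _ [u0 hu [Dfdag Ffdag _]] [a0 s0 su usa as0]] := hbasic.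
have [[_ phi_incr phi0] _ [_ _ R0gt0] _ stab] := hstab.
have [_ _ _ /andP[th0 th1] interp] := hstoch.
have [Zlin _] := hZv.
have [du hdu] := hu.
have [ds hds] : hs_space S s fdag.
  apply: (hs_space_between hS (nu1 := 0) (nu2 := u)); first by rewrite s0 ltW.
    by exists fdag; exact: power_graph0.
  by exists du.
have as_gt0 : 0 < a + s by lra.
have au_gt0 : 0 < a + u by lra.
set p := (u - s) / (a + s).
have p0 : 0 < p by rewrite divr_gt0 ?subr_gt0.
have p1 : p <= 1 by rewrite ler_pdivrMr// mul1r; lra.
have c0 : 0 <= 2 * `|du| * R0 `^ p by rewrite !mulr_ge0 ?powR_ge0.
have e0 : 0 < 1 / 4 :> R by lra.
have q02 : 0 <= 1 - p < 2 by lra.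
have [K K0 young] := Young_powR c0 e0 q02.
(* K carries the cross term, 2 the deterministic noise, 3 Ctheta^2 the random
   one; all three are independent of the noise path and of alpha *)
pose C := K + 2 + 3 * Ctheta ^+ 2.
have t20 := sqr_ge0 Ctheta.
have C0 : 0 < C by rewrite /C; lra.
exists C; split=> // w xi sigma0 delta0 alpha fhat xi1 sigma0_gt0 delta0_gt0 H.
move=> sigma delta hsigma hdelta.
have [al0 hargmin hball hQ] := H _ _ hsigma hdelta.
move: hsigma hdelta => /andP[sg0 _] /andP[dl0 _].
move: (alpha sigma delta) (fhat sigma delta) al0 hargmin hball hQ.
move=> al f al0 hargmin hball hQ {H}.
have [[fs hfs] _ _] := hball.
have hes := power_graphB hS hfs hds.
have [v iv hv] := interp _ hball.
have stab_f := stab _ hQ.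
have [ea hea] : hs_space S (- a) (f - fdag).
  by move: stab_f; rewrite /hs_enorm; case: ifPn => [/asboolP|].
move: stab_f; rewrite (hs_enormE hS hea) lee_fin => stab_f.
rewrite (hs_enormE hS hes).
rewrite (hs_normE hS hes) -Ffdag in hv.
rewrite -Ffdag in hargmin iv *.
set D := `|F f - F fdag| in stab_f hv *; set E := `|fs - ds| in hv *.
have D0 : 0 <= D by exact: normr_ge0.
have E0 : 0 <= E by exact: normr_ge0.
set z := (fun g => Z g w) in hargmin *.
have zl (c : R) g1 g2 : z (c *: g1 + g2) = c * z g1 + z g2 by exact: Zlin.
have basic := tikhonov_basic_inequality hipX hipY hS zl hfs hds Dfdag hargmin.
set conj := fenchel_conjugate _ _.
set N := dual_norm iota z.
have phiD : 0 <= phi D.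
  move: D0; rewrite le_eqVlt => /predU1P[<-|D0]; first by rewrite phi0.
  by rewrite -phi0 ltW// phi_incr.
have FY t := @Fenchel_Young_psi R phi u s a t (- (1 / (8 * C * al))).
(* the value of the supremum at t = 0 shows that the conjugate is nonnegative,
   which is needed to enlarge K to C and to exclude -oo in the sums *)
have conj0 : (0%:E <= conj)%E.
  apply: le_trans (FY 0 (lexx _)); rewrite lee_fin mul0r addr0.
  exact: powR_ge0.
have N0 : (0 <= N)%E := dual_norm_ge0.
have Nv := @le_dual_norm _ _ _ iota z v zl.
have al_th : 0 < al `^ (theta - 1) by rewrite powR_gt0.
have FYD := FY _ (sqr_ge0 D).
rewrite -/conj in FYD; rewrite -/N in Nv.
(* an infinite conjugate or dual norm makes the right-hand side infinite *)
case: conj conj0 FYD => [cj||] //; last first.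
  move=> _ _; rewrite gt0_muley ?lte_fin// addey; last first.
    by rewrite gt_eqF// (lt_le_trans (ltNyr 0))//
      adde_ge0// ?lee_fin ?sqr_ge0// !mule_ge0// ?lee_fin ?sqr_ge0// ltW.
  by rewrite gt0_muley ?lte_fin// leey.
rewrite !lee_fin => cj0 FYD.
case: N N0 Nv => [nz||] // N0 Nv; last first.
  rewrite [(+oo ^+ 2)%E]expe2 mulyy gt0_muley ?lte_fin ?exprn_gt0//.
  rewrite gt0_mulye ?lte_fin// !addye//.
  by rewrite gt0_muley ?lte_fin// leey.
move: N0 Nv; rewrite -EFinM !lee_fin => nz0 Nv.
rewrite -!expr2.
(* n is the coefficient of the random noise term once E is replaced by
   sqrt al * E, so that n^2 carries the power alpha^(theta-1) *)
pose n := sigma * nz * `|Ctheta| * al `^ ((theta - 1) / 2).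
have al_sqrt : al `^ ((theta - 1) / 2) * Num.sqrt al `^ (1 - theta) = 1.
  rewrite -powR12_sqrt ?ltW// -powRrM -powRD; last first.
    by rewrite (gt_eqF al0) implybT.
  by rewrite (_ : _ + _ = 0) ?powRr0//; field.
apply: (@absorb_errors _ C al D E (- (2 * ipX (fs - ds) ds))
  (psi_fun phi u s a (D ^+ 2)) cj n _ (sigma * z (F f - F fdag)) delta
  (delta * ipY (F f - F fdag) xi) K (Num.sqrt al * E)) => //.
- by rewrite /C; lra.
- have -> : n ^+ 2 = (sigma ^+ 2 * nz ^+ 2 * al `^ (theta - 1)) * Ctheta ^+ 2.
    rewrite /n !exprMn -(powR_mulrn 2 (powR_ge0 al _)) -powRrM divfK ?pnatr_eq0//.
    by rewrite real_normK ?num_real//; ring.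
  rewrite mulrCA [leRHS]mulrC ler_wpM2l//; last by rewrite /C; lra.
  by rewrite !mulr_ge0 ?sqr_ge0// ltW.
- have hip := source_term_bound hipX hS as0 su usa hes hea hds hdu.
  rewrite -/p -/E in hip.
  have hA : `|ea| `^ p <= R0 `^ p * phi D `^ p.
    rewrite -powRM ?(ltW R0gt0)//; apply: ge0_ler_powR; rewrite ?nnegrE//.
    - exact: ltW.
    - by rewrite mulr_ge0// ltW.
  have := young _ _ (powR_ge0 (phi D) p) E0.
  (* Young's exponent 2 / (1 + p) turns phi^p into psi: 2p/(1+p) = 2(u-s)/(a+u) *)
  have -> : psi_fun phi u s a (D ^+ 2) = (phi D `^ p) `^ (2 / (2 - (1 - p))).
    rewrite /psi_fun sqrtr_sqr (ger0_norm D0) -powRrM; congr (_ `^ _).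
    by rewrite /p; field; lra.
  apply: le_trans.
  apply: (@le_trans _ _ (2 * `|ipX (fs - ds) ds|)).
    by have := ler_norm (- ipX (fs - ds) ds); rewrite normrN; lra.
  rewrite (_ : 2 * _ * _ * _ * _ =
    2 * (`|du| * (R0 `^ p * phi D `^ p * E `^ (1 - p)))); last by ring.
  rewrite ler_wpM2l//; apply: le_trans hip _.
  by rewrite ler_wpM2l// ler_wpM2r// powR_ge0.
- rewrite ler_wpM2l ?(ltW dl0)//.
  apply: le_trans (ler_norm _) _; apply: le_trans (cauchy_schwarz hipY _ _) _.
  by rewrite ler_piMr.
- rewrite -iv.
  have zb : z (iota v) <= nz * (`|Ctheta| * D `^ theta * E `^ (1 - theta)).
    apply: le_trans (ler_norm _) _; apply: le_trans Nv _.
    rewrite ler_wpM2l//; apply: le_trans hv _.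
    by rewrite ler_wpM2r ?powR_ge0// ler_wpM2r ?powR_ge0// ler_norm.
  apply: (le_trans (ler_wpM2l (ltW sg0) zb)).
  have gm : D `^ theta * (Num.sqrt al * E) `^ (1 - theta)
      <= D + Num.sqrt al * E.
    by apply: geometric_mean_le_sum; rewrite ?mulr_ge0 ?sqrtr_ge0//; lra.
  have n0 : 0 <= n by rewrite /n !mulr_ge0 ?powR_ge0// ltW.
  apply: le_trans (ler_wpM2l n0 gm).
  rewrite (powRM _ (sqrtr_ge0 _) E0) /n.
  rewrite [leRHS](_ : _ = sigma * (nz * (`|Ctheta| * D `^ theta * E `^ (1 - theta)))
    * (al `^ ((theta - 1) / 2) * Num.sqrt al `^ (1 - theta))); last by ring.
  by rewrite al_sqrt mulr1.
Qed.
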